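(* For any $T_1$ topological space $X$, the following are equivalent: (1) $X$ is discrete; (2) $F_q(X)$ is discrete; (3) $F_q(X)$ is a topological group; (4) the square map $sq:F_q(X)\to F_q(X)$, $w\mapsto R(ww)$ (i.e. $w\mapsto w^2$ in the group), is continuous; (5) $F_q(X)$ is first countable.
   Context: Cross product: for topological spaces $X_1,X_2$, $X_1\otimes X_2$ is the set $X_1\times X_2$ with the topology in which $U$ is open iff $\{x\in X_1 : (x,y)\in U\}$ is open in $X_1$ for every $y\in X_2$ and $\{y\in X_2:(x,y)\in U\}$ is open in $X_2$ for every $x\in X_1$. $X^{\otimes n}$ is the $n$-fold iterated cross product of $X$ with itself (equivalently, $X^n$ with a set open iff each of its slices obtained by fixing all but one coordinate is open in $X$); $X^{\otimes 0}=\{e\}$ is a one-point space. For a space $Z$, $M_{st}(Z)=\coprod_{n\ge 0}Z^{\otimes n}$ (topological sum); its elements are written as words $z_1z_2\cdots z_n$, and it is a monoid under concatenation with identity the empty word $e$. For a space $X$, $X^{-1}$ is a homeomorphic copy of $X$ with elements written $x^{-1}$, and $X\sqcup X^{-1}$ is the topological sum. $F(X)$ is the free group on the set $X$, realized as the set of reduced words in $X\sqcup X^{-1}$ with operation concatenation followed by reduction, and $R:M_{st}(X\sqcup X^{-1})\to F(X)$ sends each word to its reduced form. The free quasitopological group $F_q(X)$ is $F(X)$ with the quotient topology induced by $R$. *)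

(* Defs.v *)
From HB Require Import structures.
From mathcomp Require Import all_boot.
From mathcomp Require Import all_classical topology.
Set Implicit Arguments.
Unset Strict Implicit.
Unset Printing Implicit Defensive.

Local Open Scope classical_set_scope.
Local Open Scope quotient_scope.
Local Open Scope group_scope.

Definition discrete_space (T : topologicalType) : Prop :=
  forall A : set T, open A.

Lemma discrete_spaceE (T : topologicalType) :
  discrete_space T <-> @nbhs T T = principal_filter.
Proof.
split=> [dT|nE A]; last first.
  by rewrite openE => x Ax; rewrite /interior nE; exact/principal_filterP.
apply/funext => x; apply/seteqP; split=> A.
  by move=> /nbhs_singleton Ax; exact/principal_filterP.
by move=> /principal_filterP Ax; apply: open_nbhs_nbhs; split=> //; exact: dT.
Qed.

Definition first_countable (T : topologicalType) : Prop :=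
  forall x : T, exists B : set (set T),
    [/\ countable B, B `<=` nbhs x &
        forall U, nbhs x U -> exists2 V, B V & V `<=` U].

#[short(type="preTopologicalGroupType")]
HB.structure Definition PreTopologicalGroup := {G of Topological G & Group G}.

Definition is_topological_group (G : preTopologicalGroupType) : Prop :=
  continuous (fun p : G * G => p.1 * p.2) /\ continuous (fun g : G => g^-1).

Definition cross_prod (X1 X2 : Type) : Type := (X1 * X2)%type.

Section CrossProd.
Context (X1 X2 : topologicalType).

HB.instance Definition _ := Choice.copy (cross_prod X1 X2) (X1 * X2)%type.

Definition cross_prod_open (U : set (cross_prod X1 X2)) : Prop :=
  (forall y, open [set x | U (x, y)]) /\ (forall x, open [set y | U (x, y)]).

Lemma cross_prod_openT : cross_prod_open setT.
Proof. by split=> ?; exact: openT. Qed.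

Lemma cross_prod_openI : setI_closed cross_prod_open.
Proof.
by move=> A B [A1 A2] [B1 B2]; split=> z;
  [exact: (openI (A1 z) (B1 z)) | exact: (openI (A2 z) (B2 z))].
Qed.

Lemma cross_prod_open_bigcup (I : Type) (f : I -> set (cross_prod X1 X2)) :
  (forall i, cross_prod_open (f i)) -> cross_prod_open (\bigcup_i f i).
Proof.
move=> fo; split=> z.
  apply: (@bigcup_open X1 I setT (fun i => [set x | f i (x, z)])) => i _.
  by case: (fo i).
apply: (@bigcup_open X2 I setT (fun i => [set y | f i (z, y)])) => i _.
by case: (fo i).
Qed.

HB.instance Definition _ := isOpenTopological.Build (cross_prod X1 X2)
  cross_prod_openT cross_prod_openI cross_prod_open_bigcup.

End CrossProd.

(* The n-th cross power of Z is carried by n.-tuple Z, a set being open iff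
   all of its slices in one coordinate are; [cross_pow0_open] and
   [cross_powS_open] below identify it with the iterated cross product. *)
Definition cross_pow (Z : Type) (n : nat) : Type := n.-tuple Z.

Section CrossPow.
Context (Z : topologicalType) (n : nat).

HB.instance Definition _ := Choice.copy (cross_pow Z n) (n.-tuple Z).

Definition set_coord (t : n.-tuple Z) (i : 'I_n) (z : Z) : n.-tuple Z :=
  [tuple if j == i then z else tnth t j | j < n].

Definition cross_pow_open (U : set (cross_pow Z n)) : Prop :=
  forall (t : n.-tuple Z) (i : 'I_n), open [set z | U (set_coord t i z)].

Lemma cross_pow_openT : cross_pow_open setT.
Proof. by move=> t i; exact: openT. Qed.

Lemma cross_pow_openI : setI_closed cross_pow_open.
Proof. by move=> A B Ao Bo t i; exact: (openI (Ao t i) (Bo t i)). Qed.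

Lemma cross_pow_open_bigcup (I : Type) (f : I -> set (cross_pow Z n)) :
  (forall k, cross_pow_open (f k)) -> cross_pow_open (\bigcup_k f k).
Proof.
move=> fo t i.
apply: (@bigcup_open Z I setT (fun k => [set z | f k (set_coord t i z)])).
by move=> k _; exact: fo.
Qed.

HB.instance Definition _ := isOpenTopological.Build (cross_pow Z n)
  cross_pow_openT cross_pow_openI cross_pow_open_bigcup.

End CrossPow.

Lemma cross_pow0_open (Z : topologicalType) (U : set (cross_pow Z 0)) : open U.
Proof. by move=> t []. Qed.

Lemma set_coord_lift (Z : topologicalType) n (z w : Z) (t : n.-tuple Z)
    (i : 'I_n) :
  set_coord [tuple of z :: t] (lift ord0 i) w
  = [tuple of z :: set_coord t i w].
Proof.
apply: eq_from_tnth => j; rewrite tnth_mktuple.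
case: (unliftP ord0 j) => [k ->|->].
  by rewrite (inj_eq lift_inj) !tnthS tnth_mktuple.
by rewrite !tnth0.
Qed.

Lemma set_coord_ord0 (Z : topologicalType) n (z w : Z) (t : n.-tuple Z) :
  set_coord [tuple of z :: t] ord0 w = [tuple of w :: t].
Proof.
apply: eq_from_tnth => j; rewrite tnth_mktuple.
by case: (unliftP ord0 j) => [k ->|->]; rewrite /= ?tnth0 ?tnthS.
Qed.

Lemma cross_powS_open (Z : topologicalType) n (U : set (cross_pow Z n.+1)) :
  open U <->
  open [set p : cross_prod Z (cross_pow Z n) |
          U [tuple of p.1 :: (p.2 : n.-tuple Z)]].
Proof.
split=> [Uo|[U1 U2]].
  split=> [t|z].
    have [[z Uz]|Un] := pselect (exists z, U [tuple of z :: (t : n.-tuple Z)]).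
      have := Uo [tuple of z :: (t : n.-tuple Z)] ord0.
      by under eq_set do rewrite set_coord_ord0.
    rewrite [X in open X](_ : _ = set0); first exact: open0.
    by apply/seteqP; split=> z // Uz; apply: Un; exists z.
  move=> t i; have := Uo [tuple of z :: t] (lift ord0 i).
  by under eq_set do rewrite set_coord_lift.
move=> t i; case/tupleP: t => z t.
case: (unliftP ord0 i) => [k ->|->].
  under eq_set do rewrite set_coord_lift.
  exact: (U2 z t k).
under eq_set do rewrite set_coord_ord0.
exact: (U1 t).
Qed.

(* Topological sum of the cross powers: [existT _ n t] is the word with
   letters [t], of length n. *)
Definition Mst (Z : topologicalType) : topologicalType :=
  {n : nat & cross_pow Z n}.

Definition Mst_seq (Z : topologicalType) (w : Mst Z) : seq Z :=
  projT2 w : (projT1 w).-tuple Z.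

Definition seq_Mst (Z : topologicalType) (s : seq Z) : Mst Z :=
  existT (cross_pow Z) (size s) (in_tuple s).

Lemma seq_MstK (Z : topologicalType) : cancel (@seq_Mst Z) (@Mst_seq Z).
Proof. by []. Qed.

(* Topological sum of X and X^-1: [existT _ true x] is x, and
   [existT _ false x] is x^-1. *)
Definition letter (X : topologicalType) : topologicalType := {_ : bool & X}.

Section FreeGroup.
Context (X : topologicalType).
Implicit Types (a b : letter X) (u v w : seq (letter X)).

Definition letter_inv a : letter X :=
  existT (fun _ : bool => X) (~~ projT1 a) (projT2 a).

Definition reduced w : bool := sorted (fun a b => b != letter_inv a) w.

Definition red_cons a w : seq (letter X) :=
  if w is b :: w' then if b == letter_inv a then w' else a :: w else [:: a].

Definition reduce w : seq (letter X) := foldr red_cons [::] w.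

Definition word_inv w : seq (letter X) := rev (map letter_inv w).

Lemma letter_invK : involutive letter_inv.
Proof. by case=> b x; rewrite /letter_inv /= negbK. Qed.

Lemma red_cons_reduced a w : reduced w -> reduced (red_cons a w).
Proof.
case: w => [//|b w] /=; case: ifPn => [_|ne] /=; first exact: path_sorted.
by rewrite ne.
Qed.

Lemma reduce_reduced w : reduced (reduce w).
Proof. by elim: w => [//|a w IH] /=; exact: red_cons_reduced. Qed.

Lemma reduce_id w : reduced w -> reduce w = w.
Proof.
elim: w => [//|a w IH] rw /=; rewrite IH; last exact: path_sorted rw.
by case: w rw {IH} => [//|b w] /= /andP[/negbTE ->].
Qed.

Lemma red_consK a w : reduced w -> red_cons (letter_inv a) (red_cons a w) = w.
Proof.
case: w => [_|b w] /=; first by rewrite letter_invK eqxx.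
case: (eqVneq b (letter_inv a)) => [->|ne] /=; last by rewrite letter_invK eqxx.
case: w => [//|c w] /= /andP[+ _].
by move=> /negbTE ->.
Qed.

Lemma red_consVK a w : reduced w -> red_cons a (red_cons (letter_inv a) w) = w.
Proof. by move=> /(red_consK (letter_inv a)); rewrite letter_invK. Qed.

Lemma reduce_cat_foldr u v : reduce (u ++ v) = foldr red_cons (reduce v) u.
Proof. by rewrite /reduce foldr_cat. Qed.

Lemma foldr_red_cons_reduced u w : reduced w -> reduced (foldr red_cons w u).
Proof. by move=> rw; elim: u => [//|a u IH] /=; exact: red_cons_reduced. Qed.

Lemma reduce_catr u v : reduce (u ++ reduce v) = reduce (u ++ v).
Proof. by rewrite !reduce_cat_foldr (reduce_id (reduce_reduced v)). Qed.

Lemma foldr_red_cons a u w : reduced w ->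
  foldr red_cons w (red_cons a u) = red_cons a (foldr red_cons w u).
Proof.
case: u => [//|b u] rw /=; case: eqP => [->|//].
by rewrite red_consVK// foldr_red_cons_reduced.
Qed.

Lemma reduce_catl u v : reduce (reduce u ++ v) = reduce (u ++ v).
Proof.
elim: u => [//|a u IH] /=.
by rewrite reduce_cat_foldr foldr_red_cons ?reduce_reduced// -reduce_cat_foldr IH.
Qed.

Lemma word_invK : involutive word_inv.
Proof.
by move=> w; rewrite /word_inv map_rev revK -map_comp map_id_in// => a _;
  exact: letter_invK.
Qed.

Lemma word_inv_reduced w : reduced w -> reduced (word_inv w).
Proof.
rewrite /reduced /word_inv rev_sorted sorted_map.
apply: sub_sorted => a b; apply: contraNN; rewrite /= letter_invK => /eqP ->.
by rewrite eqxx.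
Qed.

Lemma reduce_catV w : reduce (w ++ word_inv w) = [::].
Proof.
elim: w => [//|a w IH].
rewrite /word_inv /= rev_cons -cats1 catA -/(word_inv w).
by rewrite -reduce_catl IH /= eqxx.
Qed.

Lemma reduce_Vcat w : reduce (word_inv w ++ w) = [::].
Proof. by rewrite -{2}[w]word_invK reduce_catV. Qed.

Record free_group := FreeGroup {
  fg_word : seq (letter X);
  _ : reduced fg_word
}.

HB.instance Definition _ := [isSub for fg_word].
HB.instance Definition _ := [Choice of free_group by <:].

Implicit Types g h k : free_group.

Definition red_word w : free_group := FreeGroup (reduce_reduced w).

Definition fg_one : free_group := red_word [::].

Definition fg_mul g h : free_group := red_word (fg_word g ++ fg_word h).

Definition fg_inv g : free_group := red_word (word_inv (fg_word g)).

Lemma fg_wordP g : reduced (fg_word g). Proof. exact: valP g. Qed.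

Lemma fg_mulA : associative fg_mul.
Proof.
move=> g h k; apply: val_inj; rewrite /= -!/(reduce _).
by rewrite reduce_catr reduce_catl catA.
Qed.

Lemma fg_mul1g : left_id fg_one fg_mul.
Proof. by move=> g; apply: val_inj; exact: (reduce_id (fg_wordP g)). Qed.

Lemma fg_mulg1 : right_id fg_one fg_mul.
Proof.
by move=> g; apply: val_inj; rewrite /= cats0; exact: (reduce_id (fg_wordP g)).
Qed.

Lemma fg_mulVg : left_inverse fg_one fg_inv fg_mul.
Proof.
by move=> g; apply: val_inj; rewrite /= -!/(reduce _) reduce_catl reduce_Vcat.
Qed.

Lemma fg_mulgV : right_inverse fg_one fg_inv fg_mul.
Proof.
by move=> g; apply: val_inj; rewrite /= -!/(reduce _) reduce_catr reduce_catV.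
Qed.

HB.instance Definition _ :=
  isGroup.Build free_group fg_mulA fg_mul1g fg_mulg1 fg_mulVg fg_mulgV.

Definition R_map (w : Mst (letter X)) : free_group := red_word (Mst_seq w).

Definition fg_repr g : Mst (letter X) := seq_Mst (fg_word g).

Lemma fg_reprK : cancel fg_repr R_map.
Proof.
move=> g; apply: val_inj; rewrite /R_map seq_MstK.
exact: (reduce_id (fg_wordP g)).
Qed.

HB.instance Definition _ :=
  isQuotient.Build (Mst (letter X)) free_group fg_reprK.

(* The quotient map [\pi] of this quotType is [R_map]. *)
Definition Fq : Type := quotient_topology (free_group : quotType (Mst (letter X))).

HB.instance Definition _ := Topological.on Fq.
HB.instance Definition _ :=
  isGroup.Build Fq fg_mulA fg_mul1g fg_mulg1 fg_mulVg fg_mulgV.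

End FreeGroup.

Lemma Fq_openE (X : topologicalType) (U : set (Fq X)) :
  open U = open (@R_map X @^-1` U).
Proof.
rewrite {1}/open/= /quotient_open.
by congr open; rewrite /preimage; apply/seteqP; split=> w /=; rewrite unlock.
Qed.

(* Main.v *)
Require Import Defs.
From mathcomp Require Import all_boot.
From mathcomp Require Import all_classical topology.

(** Discreteness of X passes to F_q(X), and a discrete group is a topological
    group and is first countable; a topological group has a continuous square
    map.  The content lies in two implications back to the discreteness of X:
    from the continuity of the square map, and from first countability.

    Both rest on a supply of closed sets: a subset C of F_q(X) is closed as soon
    as, for all words u and v, only finitely many letters a give a product
    u a v in C, because X is T1 and C is tested one coordinate at a time
    ([Fq_openP], [Fq_closed_thin]).  Reduction only deletes letters
    ([reduce_subseq]), which makes this finiteness easy to check.  Let x be a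
    non-isolated point of X.

    - The set of all squares y^2 with y != x is closed: if u a v reduces to y y,
      then y occurs at least twice in u a v, hence at least once in u v, which
      leaves finitely many y ([punctured_squares_closed]).  If squaring were
      continuous, then so would be y |-> y^2 on X, and the complement X \ {x} of
      {x} would be closed as the preimage of that set.

    - Every neighbourhood of the identity contains arbitrarily long reduced
      words: start from the empty word and repeatedly replace w = x x^-1 w by
      x y^-1 w with y close to x and distinct from it ([open_one_long]).  Given a
      countable neighbourhood base at the identity, pick in its k-th member an
      element of length greater than k.  Only finitely many of the chosen
      elements have length at most a given n, so their set is closed; it misses
      the identity but meets every member of the base, which is absurd. *)

Set Implicit Arguments.
Unset Strict Implicit.
Unset Printing Implicit Defensive.

Local Open Scope classical_set_scope.

(** * Open sets of words *)

Lemma Mst_seqK (Z : topologicalType) : cancel (@Mst_seq Z) (@seq_Mst Z).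
Proof.
case=> n [s sz]; case/eqP: (sz) => en; case: n / en sz => sz.
rewrite /seq_Mst /Mst_seq /=; congr existT; exact: val_inj.
Qed.

Lemma set_coord_seq (Z : topologicalType) n (t : n.-tuple Z) (i : 'I_n) z :
  set_coord t i z = take i t ++ z :: drop i.+1 t :> seq Z.
Proof.
have it : i < size t by rewrite size_tuple.
apply: (@eq_from_nth _ z).
  by rewrite size_tuple size_cat /= size_take size_drop it size_tuple
    -subSn// subSS subnKC// ltnW.
move=> j; rewrite size_tuple => jn.
rewrite -[j]/(val (Ordinal jn)) -tnth_nth tnth_mktuple (tnth_nth z) -val_eqE /=.
rewrite nth_cat size_take it; case: ltngtP => [ji|ij|->]; last by rewrite subnn.
- by rewrite nth_take.
- by rewrite -[j - i]prednK ?subn_gt0//= nth_drop -subnS subnKC.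
Qed.

(** A set of words of length n is tested on one-coordinate slices, and words of
    different lengths do not interact; so the words can be handled as plain
    sequences, without recording their lengths in types. *)
Lemma Mst_openP (Z : topologicalType) (W : set (Mst Z)) :
  open W <-> forall u v, open [set z | W (seq_Mst (u ++ z :: v))].
Proof.
split=> [/sigT_openP Wo u v|Wo].
  have [[z0 _]|Wn] := pselect (exists z, W (seq_Mst (u ++ z :: v))); last first.
    rewrite [X in open X](_ : _ = set0); first exact: open0.
    by apply/seteqP; split=> z // Wz; apply: Wn; exists z.
  pose t := in_tuple (u ++ z0 :: v).
  have iP : size u < size (u ++ z0 :: v) by rewrite size_cat /= addnS ltnS leq_addr.
  have tE z : existT (cross_pow Z) _ (set_coord t (Ordinal iP) z)
      = seq_Mst (u ++ z :: v).
    apply: (can_inj (@Mst_seqK Z)); rewrite seq_MstK /Mst_seq /= set_coord_seq /=.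
    by rewrite take_size_cat// -(cat_rcons z0) drop_size_cat// size_rcons.
  have := Wo _ t (Ordinal iP).
  by congr open; apply/seteqP; split=> z /=; rewrite tE.
apply/sigT_openP => n.
change (cross_pow_open (existT (cross_pow Z) n @^-1` W)) => t i.
have := Wo (take i t) (drop i.+1 t).
congr open; apply/seteqP; split=> z /=; rewrite -set_coord_seq;
  by rewrite -[existT _ n _]Mst_seqK.
Qed.

(** * Closed sets of the free quasitopological group *)

Lemma Fq_openP (X : topologicalType) (U : set (Fq X)) :
  open U <-> forall u v, open [set a | U (red_word (u ++ a :: v))].
Proof. by rewrite Fq_openE; exact: Mst_openP. Qed.

Lemma letter_openP (X : topologicalType) (A : set (letter X)) :
  open A <-> forall b, open [set x | A (existT _ b x)].
Proof. exact: sigT_openP. Qed.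

Lemma letter_accessible (X : topologicalType) :
  accessible_space X -> accessible_space (letter X).
Proof.
move=> /accessible_finite_set_closed XT1.
apply/accessible_finite_set_closed => A finA.
rewrite -openC; apply/letter_openP => b.
rewrite openC; apply: XT1; apply: finite_preimage finA => x y _ _.
by move=> /(congr1 (fun a : letter X => projT2 a)).
Qed.

Lemma fg_word_inj (X : topologicalType) : injective (@fg_word X).
Proof. exact: val_inj. Qed.

Lemma red_word_eq (X : topologicalType) (u v : seq (letter X)) :
  red_word u = red_word v :> Fq X -> reduce u = reduce v.
Proof. exact: (congr1 (@fg_word X)). Qed.

Lemma red_word_cat (X : topologicalType) (u v : seq (letter X)) :
  red_word (u ++ v) = (red_word u * red_word v)%g :> Fq X.
Proof.
apply: fg_word_inj; change (reduce (u ++ v) = reduce (reduce u ++ reduce v)).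
by rewrite reduce_catr reduce_catl.
Qed.

Lemma red_word_letter_inj (X : topologicalType) (u v : seq (letter X)) :
  injective (fun a => red_word (u ++ a :: v) : Fq X).
Proof.
move=> a b; rewrite -![_ :: v]cat1s !red_word_cat => /mulgI /mulIg.
by move=> /red_word_eq /= [].
Qed.

(** Cancellation in the group makes every slice of C biject with the part of
    C made of products u a v, and in a T1 space finite sets are closed. *)
Lemma Fq_closed_thin (X : topologicalType) (C : set (Fq X)) :
  accessible_space X ->
  (forall u v, finite_set (C `&` range (fun a => red_word (u ++ a :: v)))) ->
  closed C.
Proof.
move=> /letter_accessible/accessible_finite_set_closed LT1 Cthin.
rewrite -openC; apply/Fq_openP => u v; rewrite openC; apply: LT1.
have f_inj := @red_word_letter_inj X u v.
apply: sub_finite_set (finite_preimage (in2W f_inj) (Cthin u v)) => a Ca.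
by split=> //; exists a.
Qed.

Lemma red_cons_subseq (X : topologicalType) (a : letter X) w :
  subseq (red_cons a w) (a :: w).
Proof.
case: w => [|b w]; first exact: subseq_refl.
rewrite /red_cons; case: ifP => _; last exact: subseq_refl.
exact: (cat_subseq (sub0seq [:: a; b]) (subseq_refl w)).
Qed.

Lemma reduce_subseq (X : topologicalType) (w : seq (letter X)) :
  subseq (reduce w) w.
Proof.
elim: w => [//|a w IH]; apply: (subseq_trans (red_cons_subseq a (reduce w))).
by rewrite /= eqxx.
Qed.

(** Products u a v have bounded length, since reduction shortens words. *)
Lemma Fq_closed_bounded_finite (X : topologicalType) (C : set (Fq X)) :
  accessible_space X ->
  (forall n, finite_set (C `&` [set g | size (fg_word g) <= n])) ->
  closed C.
Proof.
move=> XT1 Cfin; apply: Fq_closed_thin => // u v.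
apply: sub_finite_set (Cfin (size u + (size v).+1)) => g [Cg [a _ gE]].
split=> //=; rewrite -gE; apply: leq_trans (size_subseq (reduce_subseq _)) _.
by rewrite size_cat.
Qed.

(** * Continuity of the square map *)

Definition gen (X : topologicalType) (x : X) : letter X := existT _ true x.

Definition punctured_squares (X : topologicalType) (x : X) : set (Fq X) :=
  [set red_word [:: gen y; gen y] | y in [set~ x]].

Lemma gen_inj (X : topologicalType) : injective (@gen X).
Proof. by move=> x y /(congr1 (fun a : letter X => projT2 a)). Qed.

Lemma gen_neq_inv (X : topologicalType) (x y : X) : gen x != letter_inv (gen y).
Proof. by apply/eqP => /(congr1 (fun a : letter X => projT1 a)). Qed.

(** A square y y obtained from u a v needs two occurrences of y, and the single
    letter a supplies only one: so y is a letter of u or v. *)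
Lemma punctured_squares_closed (X : topologicalType) (x : X) :
  accessible_space X -> closed (punctured_squares x).
Proof.
move=> XT1; apply: Fq_closed_thin => // u v.
pose sq a : Fq X := red_word [:: a; a].
apply: (@sub_finite_set _ _ (sq @` [set` u ++ v])); last first.
  exact/finite_image/finite_seq.
move=> g [[y _ yE] [a _]]; rewrite -yE => /red_word_eq eyy.
exists (gen y) => //=; rewrite -has_pred1 has_count.
have := leq_count_subseq (pred1 (gen y)) (reduce_subseq (u ++ a :: v)).
rewrite eyy reduce_id ?/reduced /= ?gen_neq_inv// eqxx !count_cat /=.
by case: (a == _); case: (count_mem _ u); case: (count_mem _ v).
Qed.

Lemma gen_continuous (X : topologicalType) :
  continuous (fun x : X => red_word [:: gen x] : Fq X).
Proof.
apply/continuousP => U /Fq_openP/(_ [::] [::])/letter_openP/(_ true).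
exact.
Qed.

Lemma not_discrete (X : topologicalType) :
  ~ discrete_space X -> exists x : X, ~ open [set x].
Proof.
move=> ndX; apply: contrapT => noX; apply: ndX => A.
have -> : A = \bigcup_(x in A) [set x].
  by apply/seteqP; split=> [x Ax|x [_ Ay ->]//]; exists x.
apply: bigcup_open => x _.
by apply: contrapT => nox; apply: noX; exists x.
Qed.

Lemma not_isolated_neq (X : topologicalType) (x : X) (U : set X) :
  ~ open [set x] -> open U -> U x -> exists2 y, U y & y <> x.
Proof.
move=> nox Uo Ux; apply: contrapT => nU; apply: nox.
rewrite [[set x]](_ : _ = U)//; apply/seteqP; split=> [_ -> //|y Uy].
by apply: contrapT => ynx; apply: nU; exists y.
Qed.

Lemma square_continuous_discrete (X : topologicalType) :
  accessible_space X -> continuous (fun w : Fq X => (w * w)%g) ->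
  discrete_space X.
Proof.
move=> XT1 sq_cont; apply: contrapT => /not_discrete[x nox]; apply: nox.
have sqx_cont : continuous (fun y : X => red_word [:: gen y; gen y] : Fq X).
  move=> y; rewrite (_ : (fun _ => _) =
      (fun w : Fq X => (w * w)%g) \o (fun y : X => red_word [:: gen y])).
    exact: (continuous_comp (@gen_continuous X y) (sq_cont _)).
  by apply/funext => z /=; rewrite -red_word_cat.
have [/(_ sqx_cont) sqx_closed _] := continuous_closedP
  (fun y : X => red_word [:: gen y; gen y] : Fq X).
have := sqx_closed _ (punctured_squares_closed (x := x) XT1).
rewrite -openC; congr open; apply/seteqP; split=> y /=.
  by move=> nCy; apply: contrapT => ynx; apply: nCy; exists y.
move=> -> [z /= znx /red_word_eq].
by rewrite !reduce_id ?/reduced /= ?gen_neq_inv// => -[/znx].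
Qed.

(** * First countability *)

(** The words built are x y_1^-1 x y_2^-1 ... with all y_i distinct from x: the
    next factor x y^-1 is close to x x^-1 = 1, and no cancellation can occur.
    The induction needs to know that a nonempty word starts with x. *)
Lemma open_one_long (X : topologicalType) (x : X) (U : set (Fq X)) n :
  ~ open [set x] -> open U -> U 1%g ->
  exists2 g, U g & n <= size (fg_word g).
Proof.
move=> nox Uo U1.
suff [w [Uw rw nw _]] : exists w, [/\ U (red_word w), reduced w, n <= size w &
    head (gen x) w = gen x].
  by exists (red_word w) => //=; rewrite reduce_id.
elim: n => [|n [w [Uw rw nw hw]]]; first by exists [::].
have [||y Uy ynx] := @not_isolated_neq X x
    [set y | U (red_word ([:: gen x] ++ letter_inv (gen y) :: w))] nox.
  by move/Fq_openP: Uo => /(_ [:: gen x] w)/letter_openP/(_ false).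
  rewrite /= (_ : red_word _ = red_word w)//; apply: fg_word_inj.
  exact: (red_consVK (gen x) (reduce_reduced w)).
exists [:: gen x, letter_inv (gen y) & w]; split=> //=; last by rewrite ltnW.
apply/andP; split.
  by rewrite (can_eq (@letter_invK X)) (inj_eq (@gen_inj X)); apply/eqP.
case: w rw hw {Uw nw Uy} => [//|b w] rw /= hb.
by rewrite {1}hb letter_invK; apply/andP; split; [apply/eqP => /gen_inj/esym|].
Qed.

Lemma first_countable_discrete (X : topologicalType) :
  accessible_space X -> first_countable (Fq X) -> discrete_space X.
Proof.
move=> XT1 /(_ 1%g)[B [/countable_injP[f f_inj] B1 Bbase]].
apply: contrapT => /not_discrete[x nox].
(* f numbers the members of B; h picks a long element in the k-th of them. *)
have long k : exists h : Fq X,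
    forall V, B V -> f V = k -> V h /\ k < size (fg_word h).
  have [[V BV fV]|nV] := pselect (exists2 V, B V & f V = k); last first.
    by exists 1%g => V BV fV; case: nV; exists V.
  have [|h Vh hk] := @open_one_long X x V° k.+1 nox (open_interior V).
    exact: B1.
  exists h => V' BV' fV'; rewrite (f_inj V' V) ?inE//; last by rewrite fV.
  by split=> //; exact: interior_subset Vh.
have {long}[h hP] := choice long.
(* Indices that number no member of B are not controlled by h, so C keeps only
   the values of h that are long enough. *)
pose C := h @` [set k | k < size (fg_word (h k))].
have Cclosed : closed C.
  apply: Fq_closed_bounded_finite => // n.
  apply: sub_finite_set (finite_image h (finite_II n)) => g [[k /= kh <-] hn].
  by exists k => //=; exact: leq_trans kh hn.
have /Bbase[V BV VC] : nbhs (1%g : Fq X) (~` C).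
  apply: open_nbhs_nbhs; split; first by rewrite openC.
  by move=> [k /= + h1]; rewrite h1.
have [Vh kh] := hP _ V BV erefl.
by apply: (VC _ Vh); exists (f V).
Qed.

(** * Discrete spaces *)

Lemma Fq_discrete (X : topologicalType) :
  discrete_space X -> discrete_space (Fq X).
Proof.
by move=> Xd U; apply/Fq_openP => u v; apply/letter_openP => b; exact: Xd.
Qed.

Lemma discrete_continuous (T U : topologicalType) (f : T -> U) :
  discrete_space T -> continuous f.
Proof. by move=> Td; apply/continuousP => A _; exact: Td. Qed.

Lemma discrete_prod (T U : topologicalType) :
  discrete_space T -> discrete_space U -> discrete_space (T * U)%type.
Proof.
move=> /discrete_spaceE nT /discrete_spaceE nU A.
rewrite openE => -[x y] Axy; exists ([set x], [set y]) => /=.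
  by rewrite nT nU; split; exact/principal_filterP.
by move=> [_ _] [/= -> ->].
Qed.

Lemma discrete_first_countable (T : topologicalType) :
  discrete_space T -> first_countable T.
Proof.
move=> Td x; exists [set [set x]]; split=> //.
  by move=> _ ->; apply: open_nbhs_nbhs; split=> //; exact: Td.
by move=> U /nbhs_singleton Ux; exists [set x] => // _ ->.
Qed.

Theorem theorem5p10 (X : topologicalType) (X_T1 : accessible_space X) :
  [<-> discrete_space X;
       discrete_space (Fq X);
       is_topological_group (Fq X);
       continuous (fun w : Fq X => (w * w)%g);
       first_countable (Fq X)].
Proof.
split; first exact: Fq_discrete.
split.
  by move=> Fd; split; apply: discrete_continuous => //; exact: discrete_prod.
split.
  move=> [mul_cont _] w.
  exact: (cvg_comp2 cvg_id cvg_id (mul_cont (w, w))).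
split; last exact: first_countable_discrete.
by move=> /(square_continuous_discrete X_T1)/Fq_discrete/discrete_first_countable.
Qed.
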